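(* The subspace $\Sigma\subseteq\Bbbk S_\infty$ is closed under the Heisenberg product.
   Context: Let $\Bbbk$ be a field of characteristic zero and $\Bbbk S_\infty=\bigoplus_{n\ge0}\Bbbk S_n$; permutations are composed as functions. The descent set of $\sigma\in S_n$ is $\mathrm{Des}(\sigma)=\{i\in\{1,\dots,n-1\}:\sigma(i)>\sigma(i+1)\}$. For a composition $\alpha=(a_1,\dots,a_r)$ of $n$ let $J(\alpha)=\{a_1,a_1+a_2,\dots,a_1+\cdots+a_{r-1}\}$ and $X_\alpha=\sum_{\sigma\in S_n,\ \mathrm{Des}(\sigma)\subseteq J(\alpha)}\sigma\in\Bbbk S_n$. $\Sigma_n$ is the linear span of the $X_\alpha$, $\alpha$ a composition of $n$, and $\Sigma=\bigoplus_{n\ge0}\Sigma_n$. Heisenberg product of permutations: for a finite-dimensional vector space $V$, let $\Psi_V(\sigma)$, $\sigma\in S_n$, be the endomorphism of the tensor Hopf algebra $T(V)$ (concatenation product, elements of $V$ primitive) given by $v_1\cdots v_n\mapsto v_{\sigma(1)}\cdots v_{\sigma(n)}$ on $V^{\otimes n}$ and $0$ on other degrees. On $\mathrm{End}(T(V))$ put $(f\#g)(h)=\sum f(h_1)_2\,g(h_2f(h_1)_1)$ (Sweedler notation). The Heisenberg product $\#$ on $\Bbbk S_\infty$ is the bilinear product with $\Psi_V(u\#v)=\Psi_V(u)\#\Psi_V(v)$ for all finite-dimensional $V$. Explicitly, for $\sigma\in S_p$, $\tau\in S_q$, $$\sigma\#\tau=\sum_{n=\max(p,q)}^{p+q}\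 \sum_{\substack{\xi\in\mathrm{Sh}(p,n-p)\\ \eta\in\mathrm{Sh}(p+q-n,n-q)}}\xi\bigl((\sigma\eta)\times\mathrm{Id}_{n-p}\bigr)\beta_{2n-p-q,p+q-n}(\mathrm{Id}_{n-q}\times\tau),$$ where $\mathrm{Sh}(p,q)$ is the set of $\xi\in S_{p+q}$ increasing on $\{1,\dots,p\}$ and on $\{p+1,\dots,p+q\}$, $\sigma\times\tau$ is the standard parabolic product ($\sigma$ on the first block, shifted $\tau$ on the last), and $\beta_{p,q}(i)=q+i$ for $i\le p$, $\beta_{p,q}(p+i)=i$ for $i\le q$. *)

(* Defs.v *)
From HB Require Import structures.
From mathcomp Require Import all_boot all_order all_fingroup all_algebra.
From mathcomp Require Import finmap.
From mathcomp.multinomials Require Export monalg.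

Set Implicit Arguments.
Unset Strict Implicit.
Unset Printing Implicit Defensive.

Import GRing.Theory.
Local Open Scope ring_scope.

(* MathComp's product of permutations is (s * t) x = t (s x); [s \op t] is the
   composition of functions, (s \op t) x = s (t x). *)
Definition perm_comp n (s t : 'S_n) : 'S_n := (t * s)%g.

Notation "s \op t" := (perm_comp s t) (at level 40, left associativity).

(* Transport of s along m = n. The default value 1 for m <> n is never reached
   in the definition of [heis_perm] below, where all sizes agree. *)
Definition conform_perm m n (s : 'S_m) : 'S_n :=
  if m =P n is ReflectT e then cast_perm e s else 1%g.

Section ParabolicProduct.
Variables (m n : nat) (s : 'S_m) (t : 'S_n).

Definition perm_par_fun (i : 'I_(m + n)) : 'I_(m + n) :=
  match split i with
  | inl j => lshift n (s j)
  | inr j => rshift m (t j)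
  end.

Lemma perm_par_fun_inj : injective perm_par_fun.
Proof.
move=> i j; rewrite /perm_par_fun -[i]splitK -[j]splitK !unsplitK.
case: (split i) (split j) => [a|a] [b|b] /=.
- by move=> /lshift_inj /perm_inj ->.
- by move=> /eqP; rewrite eq_lrshift.
- by move=> /eqP; rewrite eq_rlshift.
- by move=> /rshift_inj /perm_inj ->.
Qed.

Definition perm_par : 'S_(m + n) := perm perm_par_fun_inj.
End ParabolicProduct.

Section Beta.
Variables p q : nat.

Definition beta_fun (i : 'I_(p + q)) : 'I_(p + q) :=
  cast_ord (addnC q p)
    match split i with
    | inl j => rshift q j
    | inr j => lshift p j
    end.

Lemma beta_fun_inj : injective beta_fun.
Proof.
move=> i j /cast_ord_inj; rewrite -[i]splitK -[j]splitK !unsplitK.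
case: (split i) (split j) => [a|a] [b|b] /=.
- by move=> /rshift_inj ->.
- by move=> /eqP; rewrite eq_rlshift.
- by move=> /eqP; rewrite eq_lrshift.
- by move=> /lshift_inj ->.
Qed.

Definition beta : 'S_(p + q) := perm beta_fun_inj.
End Beta.

Definition Sh (p q : nat) : {set 'S_(p + q)} :=
  [set xi : 'S_(p + q) |
     [forall i : 'I_(p + q), forall j : 'I_(p + q),
        ((i < j) && ((j < p) || (p <= i)))%N ==> (xi i < xi j)%N]].

(* The free module on the disjoint union of the S_n, i.e. the direct sum of
   the k[S_n], n >= 0. *)
Definition kSinf (k : fieldType) := {malg k[{n : nat & 'S_n}]}.

Definition perm_elt (k : fieldType) n (s : 'S_n) : kSinf k :=
  << Tagged (fun m => 'S_m) s >>.
Arguments perm_elt k {n} s.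

Definition heis_perm (k : fieldType) p q (s : 'S_p) (t : 'S_q) : kSinf k :=
  \sum_(maxn p q <= n < (p + q).+1)
    \sum_(xi in Sh p (n - p))
      \sum_(eta in Sh (p + q - n) (n - q))
        perm_elt k
          (conform_perm n xi
             \op conform_perm n (perm_par (s \op conform_perm p eta)
                                          (1%g : 'S_(n - p)))
             \op conform_perm n (beta (2 * n - p - q) (p + q - n))
             \op conform_perm n (perm_par (1%g : 'S_(n - q)) t)).

Definition heis (k : fieldType) (u v : kSinf k) : kSinf k :=
  \sum_(s <- msupp u) \sum_(t <- msupp v)
    (u@_s * v@_t) *: heis_perm k (tagged s) (tagged t).

(* Positions are 0-based in 'S_n, so the 1-based descent position i compares
   the values at the ordinals i.-1 and i. *)
Definition Des n (s : 'S_n) : {set 'I_n} :=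
  [set i : 'I_n | [exists j : 'I_n, (j.+1 == i :> nat) && (s i < s j)%N]].

Definition is_composition (n : nat) (a : seq nat) : bool :=
  all (fun x => 0 < x)%N a && (sumn a == n).

Definition J (a : seq nat) : seq nat :=
  [seq sumn (take i a) | i <- iota 1 (size a).-1].

Definition X (k : fieldType) (a : seq nat) : kSinf k :=
  \sum_(s : 'S_(sumn a) | [forall i in Des s, (i : nat) \in J a]) perm_elt k s.

Definition Sigma_deg (k : fieldType) (n : nat) (u : kSinf k) : Prop :=
  exists (l : seq (seq nat)) (c : seq nat -> k),
    all (is_composition n) l /\ u = \sum_(a <- l) c a *: X k a.

Definition Sigma (k : fieldType) (u : kSinf k) : Prop :=
  exists (N : nat) (w : nat -> kSinf k),
    (forall n, Sigma_deg n (w n)) /\ u = \sum_(n < N) w n.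

(* Main.v *)
Require Import Defs.
From mathcomp Require Import all_boot all_order all_fingroup all_algebra.
From mathcomp Require Import finmap zify.

Set Implicit Arguments.
Unset Strict Implicit.
Unset Printing Implicit Defensive.

(** In degree n, X_alpha # X_beta is the sum of pi \op kappa, where pi = xi (sigma x Id)
runs over the permutations increasing on the positions carrying the same row label
(rows: the parts of alpha, and one further row of n - p positions), and
kappa = (eta x Id) beta (Id x tau) runs over a set of permutations described by
comparisons of neighbouring values.  Put rho = pi \op kappa and let F i be the row
label of kappa i.  The condition on kappa becomes a condition on F alone together with
[Des rho \subset D_F] for a set D_F determined by F, and for given rho and F there is
exactly one admissible pair (pi, kappa), obtained by a stable sort.  Hence the sum equals
the sum over F of [sum_(Des rho \subset D_F) rho], and each inner sum is some X_gamma. *)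

(** * Permutations as functions on [nat] *)

(* Extending permutations by the identity to all of [nat] makes [conform_perm] invisible. *)
Definition pact n (s : 'S_n) (x : nat) : nat :=
  if insub x is Some i then val (s i) else x.

Section Pact.
Variable n : nat.
Implicit Types (s t : 'S_n) (x y : nat).

Lemma pactE s (i : 'I_n) : pact s i = s i.
Proof. by rewrite /pact valK. Qed.

Lemma pact_out s x : n <= x -> pact s x = x.
Proof. by move=> h; rewrite /pact insubF // ltnNge h. Qed.

Lemma pact_lt s x : (pact s x < n) = (x < n).
Proof.
case: (ltnP x n) => h; last by rewrite pact_out // ltnNge h.
by rewrite -[x]/(val (Ordinal h)) pactE ltn_ord.
Qed.

Lemma pact1 x : pact (1%g : 'S_n) x = x.
Proof.
case: (ltnP x n) => h; last by rewrite pact_out.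
by rewrite -[x]/(val (Ordinal h)) pactE perm1.
Qed.

Lemma pact_comp s t x : pact (s \op t) x = pact s (pact t x).
Proof.
case: (ltnP x n) => h; last by rewrite !pact_out.
by rewrite -[x]/(val (Ordinal h)) !pactE permM.
Qed.

Lemma pactK s : cancel (pact s) (pact s^-1).
Proof. by move=> x; rewrite -pact_comp /perm_comp mulgV pact1. Qed.

Lemma pactKV s : cancel (pact s^-1) (pact s).
Proof. by move=> x; rewrite -pact_comp /perm_comp mulVg pact1. Qed.

Lemma pact_inj s : injective (pact s).
Proof. exact: can_inj (pactK s). Qed.

Lemma pact_ext s t : (forall x, x < n -> pact s x = pact t x) -> s = t.
Proof.
move=> h; apply/permP => i; apply: val_inj.
by rewrite /= -!pactE h.
Qed.

Lemma pact_exists (f : nat -> nat) :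
    (forall x, x < n -> f x < n) ->
    (forall x y, x < n -> y < n -> f x = f y -> x = y) ->
  exists s : 'S_n, forall x, x < n -> pact s x = f x.
Proof.
move=> flt finj.
have g_inj : injective (fun i : 'I_n => Ordinal (flt i (ltn_ord i))).
  by move=> i j [] /finj; rewrite !ltn_ord => /(_ isT isT); apply: val_inj.
exists (perm g_inj) => x h.
by rewrite -[x]/(val (Ordinal h)) pactE permE.
Qed.

Lemma perm_pact s : perm_eq [seq pact s i | i <- iota 0 n] (iota 0 n).
Proof.
apply: uniq_perm; rewrite ?iota_uniq ?map_inj_uniq ?iota_uniq //.
  exact: pact_inj.
move=> x; rewrite mem_iota add0n /=; apply/mapP/idP => [[y]|h].
  by rewrite mem_iota add0n /= => h ->; rewrite pact_lt.
by exists (pact s^-1 x); rewrite ?pactKV // mem_iota add0n pact_lt.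
Qed.

Lemma perm_map_pact s (T : eqType) (h : nat -> T) :
  perm_eq [seq h (pact s i) | i <- iota 0 n] [seq h i | i <- iota 0 n].
Proof. rewrite (map_comp h); exact/perm_map/perm_pact. Qed.

End Pact.

Lemma pact_conform m n (s : 'S_m) x :
  m = n -> pact (conform_perm n s) x = pact s x.
Proof.
move=> emn; subst n; rewrite /conform_perm; case: eqP => // e.
by rewrite (eq_irrelevance e erefl) cast_perm_id.
Qed.

Lemma pact_par m n (s : 'S_m) (t : 'S_n) x :
  pact (perm_par s t) x = if x < m then pact s x else m + pact t (x - m).
Proof.
case: (ltnP x (m + n)) => h; last first.
  by rewrite pact_out // ltnNge (leq_trans (leq_addr _ _) h) /= pact_out; lia.
rewrite -[x in LHS]/(val (Ordinal h)) pactE permE /perm_par_fun.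
case: splitP => j /= ->; first by rewrite ltn_ord pactE.
by rewrite ltnNge leq_addr /= addKn pactE.
Qed.

Lemma pact_beta p q x :
  pact (beta p q) x = if x < p then q + x else if x < p + q then x - p else x.
Proof.
case: (ltnP x (p + q)) => h; last by rewrite pact_out //; case: ltnP; lia.
rewrite -[x in LHS]/(val (Ordinal h)) pactE permE /beta_fun /=.
case: splitP => j /= ->; first by rewrite ltn_ord.
by rewrite ltnNge leq_addr addKn.
Qed.

(** * Descent classes and shuffles as monotonicity conditions *)

Lemma DesP n (s : 'S_n) (D : pred nat) :
  reflect (forall i, i.+1 < n -> ~~ D i.+1 -> pact s i < pact s i.+1)
          [forall i in Des s, D i].
Proof.
apply: (iffP forallP) => [H i jn nD | H i].
  rewrite ltn_neqAle (inj_eq (@pact_inj _ s)) neq_ltn ltnSn /= leqNgt.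
  apply: contra nD => hs.
  have /implyP := H (Ordinal jn); apply; rewrite inE.
  apply/existsP; exists (Ordinal (ltnW jn)).
  by rewrite eqxx /= -!pactE.
apply/implyP; rewrite inE => /existsP[j /andP[/eqP e hs]].
apply: contraLR hs; rewrite -e => nD.
by rewrite -leqNgt ltnW // -!pactE -e H // e.
Qed.

(** Common form of descent classes ([h] the block index), shuffles ([h] the indicator of the second
    block) and left factors ([h] the row label). *)
Definition incr_on_ties n (h : nat -> nat) (s : 'S_n) :=
  forall i j, i < j -> j < n -> h i = h j -> pact s i < pact s j.

Lemma ShP p q (xi : 'S_(p + q)) :
  reflect (incr_on_ties (leq p) xi) (xi \in Sh p q).
Proof.
rewrite inE; apply: (iffP forallP) => [H i j ij jn e | H i].
  have iN := ltn_trans ij jn.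
  have /forallP/(_ (Ordinal jn))/implyP := H (Ordinal iN).
  by rewrite -!pactE; apply; rewrite ij /=; move: e; lia.
apply/forallP => j; apply/implyP => /andP[ij c]; rewrite -!pactE H //.
by move: c ij; lia.
Qed.

(** * Stable sorting: uniqueness and existence *)

Lemma incr_id n (f : nat -> nat) :
    (forall i, i < n -> f i < n) ->
    (forall i j, i < j -> j < n -> f i < f j) ->
  forall i, i < n -> f i = i.
Proof.
move=> flt finc.
have ge i : i < n -> i <= f i.
  elim: i => // i IH hi; have := finc i i.+1 (ltnSn _) hi.
  by have := IH (ltnW hi); lia.
have le d : d < n -> f (n.-1 - d) <= n.-1 - d.
  elim: d => [|d IH] hd; first by have := flt (n.-1 - 0); lia.
  have := finc (n.-1 - d.+1) (n.-1 - d).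
  by have := IH (ltnW hd); lia.
move=> i hi; have := ge _ hi; have := le (n.-1 - i).
by rewrite subKn; lia.
Qed.

(** As [h] is nondecreasing and preserved by [s^-1 t], an inversion of [s^-1 t] needs two positions
    with equal [h]; there [s] and [t] increase, which excludes it. So [s^-1 t] is increasing, hence
    the identity. *)
Lemma incr_on_ties_uniq n (h : nat -> nat) (s t : 'S_n) :
    (forall i j, i <= j -> j < n -> h i <= h j) ->
    incr_on_ties h s -> incr_on_ties h t ->
    (forall i, i < n -> h (pact s^-1 (pact t i)) = h i) ->
  s = t.
Proof.
move=> hm hs ht e; apply: pact_ext => x hx.
rewrite -[pact t x](pactKV s); congr pact; apply/esym.
move: x hx; apply: incr_id => [i|i j ij jn]; first by rewrite !pact_lt.
have iN := ltn_trans ij jn.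
rewrite ltnNge leq_eqVlt; apply/negP => /orP[/eqP /pact_inj /pact_inj|]; first lia.
set a := pact _ _; set b := pact _ _ => ab.
have bn : b < n by rewrite !pact_lt.
have := hm _ _ (ltnW ab) bn; rewrite !e // => hji.
have hij := hm _ _ (ltnW ij) jn.
have eij : h i = h j by lia.
have := hs _ _ ab bn; rewrite !e // => /(_ (esym eij)).
by rewrite !pactKV; have := ht _ _ ij jn eij; lia.
Qed.

(** [s] is the inverse of the ranking of positions by [f], ties broken by position. The sorted
    values are those of [h] because sorted lists that are permutations of each other coincide. *)
Lemma sort_exists n (f h : nat -> nat) :
    (forall i j, i <= j -> j < n -> h i <= h j) ->
    perm_eq [seq f i | i <- iota 0 n] [seq h i | i <- iota 0 n] ->
  exists2 s : 'S_n, forall i, i < n -> f (pact s i) = h i & incr_on_ties h s.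
Proof.
move=> hm pfh.
(* On [x < n], comparing [key x] is comparing [(f x, x)] lexicographically. *)
pose key x := f x * n + x.
pose rank (x : nat) := #|[set y : 'I_n | key y < key x]|.
have rank_mono x y : x < n -> key x < key y -> rank x < rank y.
  move=> hx hxy; apply: proper_card; apply/properP; split.
    by apply/subsetP => z; rewrite !inE => /ltn_trans; apply.
  by exists (Ordinal hx); rewrite !inE //= ltnn.
have key_inj x y : x < n -> y < n -> key x = key y -> x = y.
  move=> hx hy /(congr1 (modn^~ n)).
  by rewrite /key !modnMDl !modn_small.
have rank_inj x y : x < n -> y < n -> rank x = rank y -> x = y.
  move=> hx hy e; apply: key_inj => //.
  case: (ltngtP (key x) (key y)) => // /rank_mono; rewrite ?hx ?hy; lia.
have rank_lt x : x < n -> rank x < n.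
  move=> hx; rewrite -[X in _ < X]card_ord; apply: proper_card.
  apply/properP; split; first exact/subsetP.
  by exists (Ordinal hx); rewrite // inE ltnn.
have [r hr] := pact_exists rank_lt rank_inj.
have inc i j : i < j -> j < n -> key (pact r^-1 i) < key (pact r^-1 j).
  move=> ij jn; have iN := ltn_trans ij jn.
  case: ltnP => //; rewrite leq_eqVlt => /orP[/eqP /key_inj|].
    by rewrite !pact_lt => /(_ jn iN) /pact_inj; lia.
  by move=> /rank_mono; rewrite -!hr ?pact_lt // !pactKV => /(_ jn); lia.
(* A drop of [f] costs at least [n], which the position, being below [n], cannot make up. *)
have fmono i j : i <= j -> j < n -> f (pact r^-1 i) <= f (pact r^-1 j).
  rewrite leq_eqVlt => /orP[/eqP -> //|ij jn].
  have := inc _ _ ij jn; rewrite /key.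
  have : pact r^-1 j < n by rewrite pact_lt.
  by rewrite leqNgt => hj hk; apply/negP => hf; nia.
have fE i : i < n -> f (pact r^-1 i) = h i.
  have sorted_map (g : nat -> nat) :
      (forall i j, i <= j -> j < n -> g i <= g j) ->
      sorted leq [seq g i | i <- iota 0 n].
    move=> gm; apply/(sortedP 0) => k; rewrite size_map size_iota => hk.
    rewrite !(nth_map 0) ?size_iota ?nth_iota //; try lia.
    by apply: gm; lia.
  have e : [seq f (pact r^-1 i) | i <- iota 0 n] = [seq h i | i <- iota 0 n].
    apply: (sorted_eq leq_trans anti_leq); try exact: sorted_map.
    exact: perm_trans (perm_map_pact r^-1 f) pfh.
  move=> hi; have /(congr1 (fun s => nth 0 s i)) := e.
  by rewrite !(nth_map 0) ?size_iota ?nth_iota.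
exists r^-1%g => // i j ij jn hij.
have := inc _ _ ij jn; rewrite /key !fE ?hij ?ltn_add2l //.
exact: ltn_trans ij jn.
Qed.

(** * Blocks of a composition *)

Lemma all_iota0P (P : pred nat) m :
  reflect (forall i, i < m -> P i) (all P (iota 0 m)).
Proof. by apply: (iffP allP) => H i; have := H i; rewrite mem_iota. Qed.

Lemma map_const_in (T : eqType) (U : eqType) (f : T -> U) a (s : seq T) :
  {in s, forall x, f x = a} -> map f s = nseq (size s) a.
Proof.
move=> h; rewrite -(size_map f); apply/all_pred1P/allP => _ /mapP[x xs ->] /=.
by rewrite h.
Qed.

(* For [D] the cuts of a composition, [blk D j] is the index of the part containing
   the 0-based position [j]. *)
Definition blk (D : pred nat) j := count D (iota 1 j).

Lemma blkS D j : blk D j.+1 = blk D j + D j.+1.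
Proof. by rewrite /blk -[j.+1 in LHS]addn1 iotaD count_cat add1n /= addn0. Qed.

Lemma blk_mono D i j : i <= j -> blk D i <= blk D j.
Proof. by move=> /subnKC <-; rewrite /blk iotaD count_cat leq_addr. Qed.

Lemma blk_le D j : blk D j <= j.
Proof. by rewrite -[X in _ <= X](size_iota 1) count_size. Qed.

(** Neighbours suffice: [blk D] is nondecreasing, hence constant between two positions of equal
    index, and the ascents there chain. *)
Lemma Des_blkP n (s : 'S_n) (D : pred nat) :
  reflect (incr_on_ties (blk D) s) [forall i in Des s, D i].
Proof.
apply: (iffP (DesP s D)) => [H i j | H i hi nD]; last first.
  by apply: H => //; rewrite blkS (negPf nD) addn0.
elim: j => // j IH; rewrite ltnS leq_eqVlt => ij jn hb.
have := blk_mono D (leqnSn j); have := blkS D j => eS leS.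
case/orP: ij => [/eqP eij | ij].
  by subst j; apply: H => //; move: eS; case: (D i.+1) => /=; lia.
have := blk_mono D (ltnW ij) => leij.
apply: (@ltn_trans (pact s j)); first by apply: IH; lia.
by apply: H => //; move: eS; case: (D j.+1) => /=; lia.
Qed.

(** * Row labels and the conditions on the two factors *)

Section RowLabels.
Variables (n p q : nat) (D1 D2 : pred nat).

(** The additional row gets label 0, below the parts of alpha, since [rotpos] puts its positions
    first. *)
Definition lab x := if p <= x then 0 else (blk D1 x).+1.
(* [beta] makes positions [p, ..., n - 1] precede [0, ..., p - 1]; [rotpos x] is the rank of
   [x] in this order, for which [lab] is nondecreasing. *)
Definition rotpos x := if x < p then x + (n - p) else x - p.

Lemma rotpos_low x : x < p -> rotpos x = x + (n - p).
Proof. by rewrite /rotpos => ->. Qed.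

Lemma rotpos_high x : p <= x -> rotpos x = x - p.
Proof. by rewrite /rotpos leqNgt => /negPf ->. Qed.

(* [i] and [i.+1] lie in the same part of the composition formed by [n - q] followed by
   the composition of [q] with cuts [D2]. *)
Definition linked i :=
  (i.+1 != n - q) && ~~ ((n - q < i.+1) && D2 (i.+1 - (n - q))).

Definition left_ok (s : 'S_n) :=
  all (fun j => all (fun i => (lab i == lab j) ==> (pact s i < pact s j))
                    (iota 0 j)) (iota 0 n).

(** Meant for [(eta x Id) beta (Id x tau)]: linked pairs within the first [n - q] positions express
    that [eta] increases on its second block, later ones the descent condition on [tau], with
    [rotpos] undoing [beta]. *)
Definition right_ok (s : 'S_n) :=
  all (fun i => pact s i < p) (iota 0 (n - q)) &&
  all (fun i => linked i ==> (rotpos (pact s i) < rotpos (pact s i.+1))) (iota 0 n.-1).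

(** What [right_ok] demands of the labels alone; ties between labels are left to [cuts]. *)
Definition valid (F : nat -> nat) :=
  all (fun i => 0 < F i) (iota 0 (n - q)) &&
  all (fun i => linked i ==> (F i <= F i.+1)) (iota 0 n.-1).

(* The set [D_F] of the header, with descents indexed as in [Des]. *)
Definition cuts (F : nat -> nat) d := ~~ (linked d.-1 && (F d.-1 == F d)).

Lemma left_okP s : reflect (incr_on_ties lab s) (left_ok s).
Proof.
apply: (iffP (all_iota0P _ _)) => [H i j ij jn e | H j jn].
  by have /all_iota0P/(_ i ij) := H j jn; rewrite e eqxx.
by apply/all_iota0P => i ij; apply/implyP => /eqP; exact: H.
Qed.

Lemma right_okP s :
  reflect ((forall i, i < n - q -> pact s i < p) /\
           (forall i, i.+1 < n -> linked i -> rotpos (pact s i) < rotpos (pact s i.+1)))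
          (right_ok s).
Proof.
apply: (iffP andP) => [[/all_iota0P H1 /all_iota0P H2] | [H1 H2]].
  by split=> // i hi; apply/implyP/H2; lia.
split; apply/all_iota0P => // i hi; apply/implyP; apply: H2; lia.
Qed.

Lemma validP F :
  reflect ((forall i, i < n - q -> 0 < F i) /\
           (forall i, i.+1 < n -> linked i -> F i <= F i.+1)) (valid F).
Proof.
apply: (iffP andP) => [[/all_iota0P H1 /all_iota0P H2] | [H1 H2]].
  by split=> // i hi; apply/implyP/H2; lia.
split; apply/all_iota0P => // i hi; apply/implyP; apply: H2; lia.
Qed.

(** [rotpos] orders by label, then by position; on equal labels [s] preserves the order of
    positions, so its values may replace them. *)
Lemma rotpos_lt (s : 'S_n) x y : left_ok s -> x < n -> y < n -> x != y ->
  (rotpos x < rotpos y) =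
  (lab x < lab y) || (lab x == lab y) && (pact s x < pact s y).
Proof.
move=> /left_okP hs hx hy.
have := hs x y; have := hs y x; rewrite /lab /rotpos.
have := @blk_mono D1 x y; have := @blk_mono D1 y x.
case: (leqP p x) => hpx; case: (leqP p y) => hpy; rewrite ?ltnS ?eqSS; lia.
Qed.

(** By [rotpos_lt] each linked condition says that the labels weakly increase, and that [s \op t]
    ascends where they agree. Lying below [p] means having a positive label. *)
Lemma right_okE (s t : 'S_n) : left_ok s ->
  right_ok t = valid (lab \o pact t) &&
    [forall i in Des (s \op t), cuts (lab \o pact t) i].
Proof.
move=> hs.
have rotposE i : i.+1 < n -> (rotpos (pact t i) < rotpos (pact t i.+1)) =
    (lab (pact t i) < lab (pact t i.+1)) ||
    (lab (pact t i) == lab (pact t i.+1)) &&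
    (pact s (pact t i) < pact s (pact t i.+1)).
  move=> hi; rewrite (rotpos_lt hs) ?pact_lt ?(ltnW hi) //.
  by rewrite (inj_eq (@pact_inj _ t)) neq_ltn ltnSn.
apply/right_okP/andP => [[H1 H2] | [/validP[/= H1 H2] /DesP H3]].
  have H i : i.+1 < n -> linked i ->
      (lab (pact t i) < lab (pact t i.+1)) ||
      (lab (pact t i) == lab (pact t i.+1)) &&
      (pact (s \op t) i < pact (s \op t) i.+1).
    by move=> hi li; rewrite !pact_comp -rotposE ?H2.
  split; last first.
    apply/DesP => i hi; rewrite negbK /= => /andP[li /eqP e].
    by have := H i hi li; rewrite e; lia.
  apply/validP; split=> i hi /=; last by move=> /(H i hi); lia.
  by rewrite /lab; have := H1 _ hi; case: leqP.
split=> i hi; first by have := H1 _ hi; rewrite /lab; case: (leqP p (pact t i)).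
move=> li; rewrite rotposE //.
have := H2 i hi li; rewrite leq_eqVlt => /orP[e|-> //].
have := H3 i hi; rewrite /cuts /= li e negbK /= !pact_comp => ->; lia.
Qed.

(* Labels equivalent to [lab], but nondecreasing for the usual order of positions. *)
Definition rowof x := if p <= x then p.+1 else blk D1 x.

Lemma rowof_mono i j : i <= j -> j < n -> rowof i <= rowof j.
Proof.
move=> ij jn; have := blk_mono D1 ij; have := blk_le D1 i; rewrite /rowof.
by case: (leqP p i); case: (leqP p j); lia.
Qed.

Lemma rowof_lab i j : (rowof i == rowof j) = (lab i == lab j).
Proof.
have := blk_le D1 i; have := blk_le D1 j; rewrite /rowof /lab.
by case: (leqP p i); case: (leqP p j); lia.
Qed.

Lemma ties_rowof (s : 'S_n) : incr_on_ties rowof s <-> incr_on_ties lab s.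
Proof.
split=> H i j ij jn /eqP e; apply: H => //; apply/eqP.
  by rewrite rowof_lab.
by rewrite -rowof_lab.
Qed.

(** A finite function, so that sums can range over label words; [inord] never meets its default, by
    [lab_lt]. *)
Definition labF (t : 'S_n) : {ffun 'I_n -> 'I_p.+1} :=
  [ffun i : 'I_n => inord (lab (pact t i))].

Definition natF (F : {ffun 'I_n -> 'I_p.+1}) x : nat :=
  if insub x is Some i then F i else 0.

Lemma lab_lt x : lab x < p.+1.
Proof. by rewrite /lab; have := blk_le D1 x; case: (leqP p x); lia. Qed.

Lemma natF_labF t x : x < n -> natF (labF t) x = lab (pact t x).
Proof.
by move=> hx; rewrite /natF insubT ffunE inordK ?lab_lt.
Qed.

(** The labels fix which positions [r \op t^-1] ties together, so [incr_on_ties_uniq] determines it.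
    That lemma wants a nondecreasing [h], whence [rowof]. *)
Lemma labF_inj (r : 'S_n) :
  {in [set t | left_ok (r \op t^-1)] &, injective labF}.
Proof.
move=> t u; rewrite !inE => /left_okP/ties_rowof ht /left_okP/ties_rowof hu e.
have : r \op t^-1 = r \op u^-1.
  apply: (incr_on_ties_uniq rowof_mono ht hu) => i hi.
  rewrite /perm_comp invMg invgK -!/(perm_comp _ _) !pact_comp pactK.
  have hv : pact u^-1 i < n by rewrite pact_lt.
  apply/eqP; rewrite -{2}[i](pactKV u) rowof_lab.
  by rewrite -(natF_labF t hv) -(natF_labF u hv) e.
by rewrite /perm_comp => /mulIg /invg_inj.
Qed.

(** Stably sorting the labels of [u], carried along [r], gives a left factor [s], and [s^-1 \op r]
    has the labels of [u]. *)
Lemma labF_image (r : 'S_n) :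
  [set labF t | t : 'S_n] = labF @: [set t | left_ok (r \op t^-1)].
Proof.
apply/eqP; rewrite eqEsubset; apply/andP; split; last first.
  by apply: imsetS; apply/subsetP.
apply/subsetP => _ /imsetP[u _ ->].
have [|s hs /ties_rowof/left_okP ls] :=
  @sort_exists n (fun x => rowof (pact u (pact r^-1 x))) rowof rowof_mono.
  apply: perm_trans (perm_map_pact r^-1 (fun x => rowof (pact u x))) _.
  exact: (perm_map_pact u rowof).
apply/imsetP; exists (s^-1 \op r).
  rewrite inE; suff -> : r \op (s^-1 \op r)^-1 = s by [].
  by rewrite /perm_comp invMg invgK mulgKV.
apply/ffunP => i; rewrite !ffunE; congr inord.
apply/eqP; rewrite -rowof_lab pact_comp.
by rewrite -(hs (pact s^-1 (pact r i))) ?pact_lt // pactKV pactK pactE.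
Qed.

Lemma right_ok_natF (r t : 'S_n) : left_ok (r \op t^-1) ->
  right_ok t = valid (natF (labF t)) &&
    [forall i in Des r, cuts (natF (labF t)) i].
Proof.
move=> hl; have -> : right_ok t = valid (lab \o pact t) &&
    [forall i in Des r, cuts (lab \o pact t) i].
  by rewrite (right_okE t hl) /perm_comp mulKVg.
congr (_ && _).
  apply/validP/validP => -[H1 H2]; split=> i hi /=.
  - rewrite natF_labF; [exact: H1 | lia].
  - by rewrite !natF_labF ?(ltnW hi) //; exact: H2.
  - by rewrite -natF_labF; [exact: H1 | lia].
  - by rewrite -!natF_labF ?(ltnW hi) //; exact: H2.
apply: eq_forallb => i; congr (_ ==> _).
by rewrite /cuts !natF_labF //; case: i => /= i; lia.
Qed.

End RowLabels.

(** * The left factor xi (sigma x Id) *)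

Section LeftFactor.
Variables (n p : nat) (D1 : pred nat).
Hypothesis hp : p <= n.

Let ep : p + (n - p) = n := subnKC hp.

Definition left_prod (su : 'S_p * 'S_(p + (n - p))) : 'S_n :=
  conform_perm n su.2 \op conform_perm n (perm_par su.1 (1%g : 'S_(n - p))).

Definition left_dom : {set 'S_p * 'S_(p + (n - p))} :=
  [set su | [forall i in Des su.1, D1 i] & su.2 \in Sh p (n - p)].

Lemma left_prodE su x :
  pact (left_prod su) x = pact su.2 (if x < p then pact su.1 x else x).
Proof.
rewrite /left_prod pact_comp !pact_conform // pact_par pact1.
by case: ltnP => // h; rewrite (subnKC h).
Qed.

Lemma left_domP su :
  reflect (incr_on_ties (blk D1) su.1 /\ incr_on_ties (leq p) su.2)
          (su \in left_dom).
Proof.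
by rewrite inE; apply: (iffP andP) => -[/Des_blkP ? /ShP ?].
Qed.

(** The values of the product on positions below [p] are those of the shuffle on its first block,
    and they determine the shuffle, which then cancels. *)
Lemma left_prod_inj : {in left_dom &, injective left_prod}.
Proof.
move=> [s u] [s' u'] /left_domP[/= _ hu] /left_domP[/= _ hu'] e.
have E x : pact u (if x < p then pact s x else x) =
           pact u' (if x < p then pact s' x else x).
  by rewrite -(left_prodE (s, u)) e left_prodE.
have eu : u = u'.
  apply: incr_on_ties_uniq hu hu' _; first by move=> i j; lia.
  move=> i hi; congr nat_of_bool.
  have [hip|hip] := ltnP i p.
    have := E (pact s'^-1 i); rewrite !pact_lt hip pactKV => <-.
    by rewrite pactK leqNgt !pact_lt hip.
  by have := E i; rewrite ltnNge hip /= => <-; rewrite pactK.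
subst u'; congr (_, _); apply: pact_ext => x hx.
by have := E x; rewrite hx => /pact_inj.
Qed.

Lemma left_prod_image :
  left_prod @: left_dom = [set s | left_ok p D1 s].
Proof.
apply/setP => r; rewrite inE; apply/imsetP/left_okP => [[[s u]] | hr].
  move=> /left_domP[/= hs hu] -> i j ij jn.
  rewrite !left_prodE /= /lab; case: (leqP p j) => hj; case: (leqP p i) => hi //.
    by move=> _; apply: hu; lia.
  move=> [e]; have := hs i j ij hj e => hsij.
  have si : pact s i < p by rewrite pact_lt.
  have sj : pact s j < p by rewrite pact_lt.
  by apply: hu; lia.
(* The shuffle whose first block takes the values of [r] on the positions below [p]. *)
have [||u hu hinc] := @sort_exists (p + (n - p))
    (fun x => p <= pact r^-1 x : nat) (leq p).
- by move=> i j; lia.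
- rewrite ep; exact: (perm_map_pact r^-1 (fun x => nat_of_bool (p <= x))).
have ulow i : i < n -> (pact r^-1 (pact u i) < p) = (i < p).
  by move=> hi; have := hu i; lia.
have ult x : (pact u^-1 x < n) = (x < n) by have := pact_lt u^-1 x; lia.
have vlow i : i < n -> (pact u^-1 (pact r i) < p) = (i < p).
  by move=> hi; rewrite -ulow ?ult ?pact_lt // pactKV pactK.
have [||s hs] := @pact_exists p (fun x => pact u^-1 (pact r x)).
- by move=> x hx; rewrite vlow //; lia.
- by move=> x y _ _ /pact_inj /pact_inj.
(* On the last [n - p] positions [u] and [r] increase with the same values, so [u^-1 r] is the
   identity there. *)
have high i : i < n - p -> pact u^-1 (pact r (p + i)) - p = i.
  move: i; apply: incr_id => [i hi | i j ij jn].
    have : pact u^-1 (pact r (p + i)) < n by rewrite ult pact_lt; lia.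
    lia.
  set a := pact u^-1 _; set b := pact u^-1 _.
  have ha : p <= a by rewrite leqNgt vlow; lia.
  have hb : p <= b by rewrite leqNgt vlow; lia.
  have hbn : b < n by rewrite ult pact_lt; lia.
  have han : a < p + (n - p) by rewrite ep ult pact_lt; lia.
  suff : a < b by lia.
  have : pact r (p + i) < pact r (p + j).
    by apply: hr; rewrite /lab ?leq_addr //; lia.
  case: (ltngtP a b) => // [ba|ab].
    have := hinc _ _ ba han; rewrite ha hb => /(_ erefl).
    by rewrite !pactKV; lia.
  by move: ab => /pact_inj ->; lia.
have highE i : p <= i -> i < n -> pact u i = pact r i.
  move=> hi hin; have := high (i - p); rewrite (subnKC hi) => h.
  have h' := vlow i hin.
  rewrite -[RHS](pactKV u); congr pact.
  by move: h h'; lia.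
exists (s, u); last first.
  apply: pact_ext => x hx; rewrite left_prodE /=.
  case: ltnP => h; first by rewrite hs // pactKV.
  by rewrite highE.
apply/left_domP; split=> //= i j ij jp hb; rewrite !hs ?(ltn_trans ij jp) //.
  set a := pact u^-1 _; set b := pact u^-1 _.
  have ha : a < p by rewrite vlow; lia.
  have hbp : b < p by rewrite vlow; lia.
  have : pact r i < pact r j.
    apply: hr => //; first lia.
    by rewrite /lab !(leqNgt p) jp (ltn_trans ij jp) /= hb.
  case: (ltngtP a b) => // [ba|ab].
    have : pact u b < pact u a by apply: hinc; lia.
    by rewrite !pactKV; lia.
  by move: ab => /pact_inj ->; lia.
Qed.

End LeftFactor.

(** * The right factor (eta x Id) beta (Id x tau) *)

Section RightFactor.
Variables (n p q : nat) (D2 : pred nat).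
Hypotheses (hp : p <= n) (hq : q <= n) (hn : n <= p + q).

(** The overlap of the two factors: [c + l = p], [c + m = q] and [l + c + m = n]. *)
Local Notation c := (p + q - n).
Local Notation l := (n - q).
Local Notation m := (n - p).

Definition right_prod (tu : 'S_q * 'S_(c + l)) : 'S_n :=
  conform_perm n (perm_par (conform_perm p tu.2) (1%g : 'S_m))
    \op conform_perm n (beta (2 * n - p - q) c)
    \op conform_perm n (perm_par (1%g : 'S_l) tu.1).

Definition right_dom : {set 'S_q * 'S_(c + l)} :=
  [set tu | [forall i in Des tu.1, D2 i] & tu.2 \in Sh c l].

Lemma right_domP tu :
  reflect ((forall i, i.+1 < q -> ~~ D2 i.+1 -> pact tu.1 i < pact tu.1 i.+1) /\
           incr_on_ties (leq c) tu.2)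
          (tu \in right_dom).
Proof.
by rewrite inE; apply: (iffP andP) => -[/DesP ? /ShP ?].
Qed.

Lemma right_prodE tu x : x < n ->
  pact (right_prod tu) x =
    if x < l then pact tu.2 (c + x) else
    let y := pact tu.1 (x - l) in
    if y < m then p + y else pact tu.2 (y - m).
Proof.
move=> hx; rewrite /right_prod !pact_comp !pact_conform; try lia.
rewrite !pact_par !pact_beta !pact1 !pact_conform; try lia.
case: (ltnP x l) => hl.
  have -> : x < 2 * n - p - q by lia.
  by have -> : c + x < p by lia.
have hy : pact tu.1 (x - l) < q by rewrite pact_lt; lia.
set y := pact _ _ in hy *.
have [ym|ym] := ltnP y m => /=.
  have -> : l + y < 2 * n - p - q by lia.
  have -> : (c + (l + y) < p) = false by lia.
  lia.
have -> : (l + y < 2 * n - p - q) = false by lia.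
have -> : l + y < 2 * n - p - q + c by lia.
have -> : l + y - (2 * n - p - q) = y - m by lia.
by have -> : y - m < p by lia.
Qed.

(** The first [l] positions show [eta] on its second block, which determines this shuffle. Then
    [tau] is read off, since exactly its values below [m] are sent to [p] or beyond. *)
Lemma right_prod_inj : {in right_dom &, injective right_prod}.
Proof.
move=> [t u] [t' u'] /right_domP[/= _ hu] /right_domP[/= _ hu'] e.
have E x : x < n -> (if x < l then pact u (c + x) else
    let y := pact t (x - l) in if y < m then p + y else pact u (y - m)) =
    (if x < l then pact u' (c + x) else
    let y := pact t' (x - l) in if y < m then p + y else pact u' (y - m)).
  by move=> hx; rewrite -(right_prodE (t, u)) // e right_prodE.
have high j : c <= j -> j < p -> pact u j = pact u' j.
  move=> cj jp; have := E (j - c).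
  have -> : j - c < l by lia.
  by rewrite (subnKC cj); apply; lia.
have eu : u = u'.
  apply: incr_on_ties_uniq hu hu' _; first by move=> i j; lia.
  move=> i hi; congr nat_of_bool.
  have [ci|ci] := leqP c i; first by rewrite -high ?pactK //; lia.
  apply/negbTE; rewrite -ltnNge ltnNge; apply/negP => ck.
  have hk : pact u^-1 (pact u' i) < c + l by rewrite !pact_lt.
  have := high _ ck; rewrite pactKV => /(_ _)/pact_inj; lia.
subst u'; congr (_, _); apply: pact_ext => y hy.
have hyn : l + y < n by lia.
have := E _ hyn; have -> : (l + y < l) = false by lia.
rewrite addKn /=.
have hc : c + l = p by lia.
have a z : m <= z -> z < q -> pact u (z - m) < p.
  by move=> mz hz; have := pact_lt u (z - m); lia.
have := a (pact t y); have := a (pact t' y); rewrite !pact_lt hy.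
have i1 : pact u (pact t y - m) = pact u (pact t' y - m) ->
  pact t y - m = pact t' y - m by exact: pact_inj.
by case: (ltnP (pact t y) m); case: (ltnP (pact t' y) m); lia.
Qed.

(** Past [l], a value [y] of [tau] yields [rotpos] equal to [y] if [y < m], and to [m] plus a value
    of [eta] otherwise; as [eta] increases on its first block, ascents of [tau] survive. *)
Lemma right_prod_ok tu : tu \in right_dom -> right_ok p q D2 (right_prod tu).
Proof.
case: tu => t u /right_domP[/= ht hu].
have ult x : (pact u x < p) = (x < p) by have := pact_lt u x; lia.
apply/right_okP; split=> [i hi | i hi].
  by rewrite right_prodE ?hi /=; [rewrite ult; lia | lia].
rewrite /linked => /andP[il il2]; rewrite !right_prodE ?(ltnW hi) //=.
have [hil|hil] := ltnP i.+1 l.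
  rewrite (ltnW hil) /rotpos !ult.
  have -> : c + i < p by lia.
  have -> : c + i.+1 < p by lia.
  by rewrite ltn_add2r; apply: hu; lia.
have -> : (i < l) = false by lia.
have := ht (i - l); have -> : (i - l).+1 = i.+1 - l by lia.
have nD : ~~ D2 (i.+1 - l) by move: il2; rewrite negb_and; case/orP => //; lia.
rewrite nD => /(_ _ isT).
have hy : pact t (i - l) < q by rewrite pact_lt; lia.
have hy' : pact t (i.+1 - l) < q by rewrite pact_lt; lia.
set y := pact t (i - l) in hy *; set y' := pact t (i.+1 - l) in hy' *.
move=> /(_ _) yy; have {}yy : y < y' by apply: yy; lia.
have uy := ult (y - m); have uy' := ult (y' - m).
have [ym|ym] := ltnP y m; have [ym'|ym'] := ltnP y' m.
- by rewrite !rotpos_high ?leq_addr // !addKn.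
- by rewrite rotpos_high ?leq_addr // rotpos_low ?uy'; lia.
- by lia.
by rewrite !rotpos_low ?uy ?uy' ?ltn_add2r; [apply: hu | |]; lia.
Qed.

Lemma right_prod_image : right_prod @: right_dom = [set s | right_ok p q D2 s].
Proof.
apply/setP => r; rewrite inE; apply/imsetP/idP => [[tu htu ->] | ].
  exact: right_prod_ok.
case/right_okP => H1 H2.
(* Here all values are below [p], where [rotpos] is a shift, and neighbours are linked. *)
have rinc j : j < l -> forall i, i < j -> pact r i < pact r j.
  elim: j => // j IH jl i; rewrite ltnS leq_eqVlt => ij.
  have rj : pact r j < pact r j.+1.
    have := H2 j; rewrite /linked /rotpos !H1 ?ltn_add2r ?(ltnW jl) //.
    by apply; lia.
  case/orP: ij => [/eqP -> // | ij].
  exact: ltn_trans (IH (ltnW jl) i ij) rj.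
(* The shuffle whose second block takes the values of [r] on the first [l] positions. *)
have [||u hu hinc] := @sort_exists (c + l)
    (fun x => pact r^-1 x < l : nat) (leq c).
- by move=> i j; lia.
(* Among all [n] values exactly [l] come from the first [l] positions, all below [p]; the [m] zeros
   of the other values are cancelled. *)
- have := perm_map_pact r^-1 (fun x => nat_of_bool (x < l)).
  have -> : iota 0 n = iota 0 (c + l) ++ iota (c + l) m.
    by rewrite -iotaD; congr iota; lia.
  rewrite map_cat (@map_const_in _ _ _ 0 (iota (c + l) m)) => [|x]; last first.
    rewrite mem_iota => hx; case: ltnP => // hl.
    by have := H1 _ hl; rewrite pactKV; lia.
  have -> : iota 0 (c + l) ++ iota (c + l) m = iota 0 l ++ iota l (c + m).
    by rewrite -!iotaD; congr iota; lia.
  rewrite map_cat (@map_const_in _ _ _ 1 (iota 0 l)) => [|x]; last first.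
    by rewrite mem_iota; lia.
  rewrite (@map_const_in _ _ _ 0 (iota l (c + m))) => [|x]; last first.
    by rewrite mem_iota; lia.
  rewrite !size_iota nseqD catA perm_cat2r => /perm_trans; apply.
  rewrite perm_catC iotaD map_cat (@map_const_in _ _ _ 0 (iota 0 c)) => [|x].
    rewrite (@map_const_in _ _ _ 1 (iota _ l)) ?size_iota // => x.
    by rewrite mem_iota; lia.
  by rewrite mem_iota; lia.
have ulow j : j < p -> (pact r^-1 (pact u j) < l) = (c <= j).
  by move=> hj; have := hu j; lia.
have ult x : (pact u^-1 x < p) = (x < p) by have := pact_lt u^-1 x; lia.
have vlow x : x < n -> pact r x < p -> (c <= pact u^-1 (pact r x)) = (x < l).
  by move=> hx hr; rewrite -ulow ?ult // pactKV pactK.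
have uV x y : pact r x < pact r y -> pact r y < p ->
    (c <= pact u^-1 (pact r x)) = (c <= pact u^-1 (pact r y)) ->
    pact u^-1 (pact r x) < pact u^-1 (pact r y).
  move=> hxy hy e; rewrite ltnNge; apply/negP => ba.
  have xlt := ult (pact r x); have ylt := ult (pact r y).
  move: ba; rewrite leq_eqVlt => /orP[/eqP /pact_inj|ba]; first lia.
  have := hinc _ _ ba; rewrite !pactKV; lia.
have high x : x < l -> pact u^-1 (pact r x) - c = x.
  move: x; apply: incr_id => [i hi | i j ij jn].
    have := H1 _ hi; rewrite -ult; lia.
  have il := ltn_trans ij jn.
  have := @uV i j (rinc _ jn _ ij) (H1 _ jn).
  have := vlow i _ (H1 _ il); have := vlow j _ (H1 _ jn); lia.
have highE x : x < l -> pact u (c + x) = pact r x.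
  move=> hx; rewrite -[RHS](pactKV u); congr pact.
  have := high _ hx; have := vlow x; rewrite H1 //; lia.
(* [right_prodE] solved for [tau]. *)
pose f y := let v := pact r (l + y) in
  if p <= v then v - p else m + pact u^-1 v.
have fE y : y < q -> let v := pact r (l + y) in
    v < n /\ (v < p -> pact u^-1 v < c).
  move=> hy /=; split; first by rewrite pact_lt; lia.
  by move=> h; have := @vlow (l + y) _ h; lia.
have [||t ht] := @pact_exists q f.
- by move=> y /fE /=; rewrite /f; case: (leqP p (pact r (l + y))); lia.
- move=> x y /fE /= hx /fE /= hy.
  have i1 : pact r (l + x) = pact r (l + y) -> l + x = l + y by exact: pact_inj.
  have i2 : pact u^-1 (pact r (l + x)) = pact u^-1 (pact r (l + y)) ->
    pact r (l + x) = pact r (l + y) by exact: pact_inj.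
  by rewrite /f; case: (leqP p (pact r (l + x))); case: (leqP p (pact r (l + y))); lia.
exists (t, u); last first.
  apply: pact_ext => x hx; rewrite right_prodE //=.
  case: ltnP => h; first by rewrite highE.
  have hxl : x - l < q by lia.
  have := fE _ hxl; rewrite ht // /f (subnKC h) /=.
  case: (leqP p (pact r x)) => hpr [h1 h2]; last first.
    by rewrite ltnNge leq_addr /= addKn pactKV.
  have -> : pact r x - p < m by lia.
  lia.
apply/right_domP; split=> //= y hy nD; rewrite !ht ?(ltnW hy) //.
have H : rotpos n p (pact r (l + y)) < rotpos n p (pact r (l + y).+1).
  apply: H2; first lia; rewrite /linked.
  have -> : (l + y).+1 - l = y.+1 by lia.
  by rewrite (negbTE nD) andbF andbT; lia.
have [_ h] := fE _ hy; have [_ h'] := fE _ (ltnW hy); move: h h' H.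
have := @uV (l + y) (l + y).+1; rewrite /f addnS.
have := pact_lt r (l + y); have := pact_lt r (l + y).+1.
set v := pact r (l + y); set w := pact r (l + y).+1.
case: (leqP p v) => hv; case: (leqP p w) => hw.
- by rewrite !rotpos_high.
- by rewrite (rotpos_high _ hv) (rotpos_low _ hw); lia.
- by rewrite (rotpos_low _ hv) (rotpos_high _ hw); lia.
by rewrite !rotpos_low // ltn_add2r; lia.
Qed.

End RightFactor.

(** * Descent class sums and compositions *)

Import GRing.Theory.
Local Open Scope ring_scope.

(** Indexed by a degree and a set of cuts, so that [cuts] can be used before any composition is
    built. *)
Definition Xdes (k : fieldType) n (D : pred nat) : kSinf k :=
  \sum_(s : 'S_n | [forall i in Des s, D i]) perm_elt k s.

Lemma J_rcons a x : J (rcons a x) = [seq sumn (take i a) | i <- iota 1 (size a)].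
Proof.
rewrite /J size_rcons /=; apply/eq_in_map => i; rewrite mem_iota => hi.
by rewrite -cats1 takel_cat //; lia.
Qed.

(** The last part [x.+1] stays open: at [n.+1] it grows by one or, if [n.+1] is a cut, is closed and
    a new part 1 starts. The total is [n.+1]. *)
Lemma composition_exists (D : pred nat) n :
  exists b x, [/\ all (fun y => 0 < y)%N b, sumn b + x = n
    & J (rcons b x.+1) = [seq i <- iota 1 n | D i]]%N.
Proof.
elim: n => [|n [b [x [pos sb Jb]]]]; first by exists [::], 0%N.
have iS m : iota 1 m.+1 = iota 1 m ++ [:: m.+1].
  by rewrite -[m.+1 in LHS]addn1 iotaD add1n.
rewrite iS filter_cat /=; case hD: (D n.+1); last first.
  by exists b, x.+1; rewrite cats0 -Jb !J_rcons; split=> //; lia.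
exists (rcons b x.+1), 0%N; split.
- by rewrite all_rcons.
- by rewrite sumn_rcons; lia.
rewrite J_rcons size_rcons iS map_cat -Jb J_rcons /=; congr cat.
  apply/eq_in_map => i; rewrite mem_iota => hi.
  by rewrite -cats1 takel_cat //; lia.
by rewrite take_oversize ?size_rcons // sumn_rcons; congr [:: _]; lia.
Qed.

Lemma eq_Xdes (k : fieldType) n (D E : pred nat) :
  (forall i, 0 < i < n -> D i = E i)%N -> Xdes k n D = Xdes k n E.
Proof.
move=> h; apply: eq_bigl => s; apply/DesP/DesP => H i hi.
  by rewrite -h // => /H; apply.
by rewrite h // => /H; apply.
Qed.

Lemma Sigma_deg_Xdes (k : fieldType) n (D : pred nat) : Sigma_deg n (Xdes k n D).
Proof.
suff [a ca ->] : exists2 a, is_composition n a & Xdes k n D = X k a.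
  by exists [:: a], (fun=> 1); rewrite /= ca big_seq1 scale1r.
case: n => [|n].
  (* [composition_exists] yields positive totals only, so degree 0 takes the empty composition. *)
  by exists [::] => //; apply: eq_Xdes => i; lia.
have [b [x [pos sb Jb]]] := composition_exists D n.
have sa : (sumn (rcons b x.+1) = n.+1)%N by rewrite sumn_rcons; lia.
exists (rcons b x.+1); first by rewrite /is_composition all_rcons pos sa /=.
rewrite -[RHS]/(Xdes k _ (mem (J (rcons b x.+1)))) sa Jb.
apply: eq_Xdes => i hi.
by rewrite /= mem_filter mem_iota add1n hi andbT.
Qed.

(** * Sigma as a linear subspace *)

Section SigmaModule.
Variable k : fieldType.
Implicit Types u v w : kSinf k.

(** Lists in [Sigma_deg] may have repetitions; multiplicities over a common duplicate-free list let
    two combinations be added. *)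
Lemma sum_mul_count (V : nmodType) (T : eqType) (f : T -> V) (l m : seq T) :
  uniq m -> {subset l <= m} ->
  \sum_(a <- l) f a = \sum_(a <- m) f a *+ count_mem a l.
Proof.
move=> um; elim: l => [|x l IH] s; first by rewrite big_nil big1.
rewrite big_cons IH; last by move=> y hy; apply: s; rewrite inE hy orbT.
have xm : x \in m by apply: s; rewrite inE eqxx.
under [RHS]eq_bigr => a _ do rewrite /= mulrnDr.
rewrite big_split /= [X in _ = X + _](bigD1_seq x) //= eqxx mulr1n.
rewrite [X in _ = _ + X + _]big1 ?addr0 // => a /negPf.
by rewrite eq_sym => ->.
Qed.

Lemma Sigma_deg0 n : Sigma_deg n (0 : kSinf k).
Proof. by exists [::], (fun=> 0); rewrite big_nil. Qed.

Lemma Sigma_degZ n c u : Sigma_deg n u -> Sigma_deg n (c *: u).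
Proof.
move=> [l [d [hl ->]]]; exists l, (fun a => c * d a); split => //.
by rewrite scaler_sumr; apply: eq_bigr => a _; rewrite scalerA.
Qed.

Lemma Sigma_degD n u v : Sigma_deg n u -> Sigma_deg n v -> Sigma_deg n (u + v).
Proof.
move=> [l [c [hl ->]]] [l' [c' [hl' ->]]].
exists (undup (l ++ l')), (fun a => c a *+ count_mem a l + c' a *+ count_mem a l').
split.
  apply/allP => a; rewrite mem_undup mem_cat => /orP[]; exact: allP.
have um := undup_uniq (l ++ l').
have sl : {subset l <= undup (l ++ l')}.
  by move=> a ha; rewrite mem_undup mem_cat ha.
have sl' : {subset l' <= undup (l ++ l')}.
  by move=> a ha; rewrite mem_undup mem_cat ha orbT.
rewrite (sum_mul_count _ um sl) (sum_mul_count _ um sl') -big_split.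
by apply: eq_bigr => a _; rewrite /= scalerDl !scalerMnl.
Qed.

Lemma Sigma_deg_sum n (I : Type) (r : seq I) (P : pred I) (F : I -> kSinf k) :
  (forall i, P i -> Sigma_deg n (F i)) -> Sigma_deg n (\sum_(i <- r | P i) F i).
Proof.
by move=> h; apply: big_ind => //; [exact: Sigma_deg0 | exact: Sigma_degD].
Qed.

Lemma Sigma_of_deg n u : Sigma_deg n u -> Sigma u.
Proof.
move=> hu; exists n.+1, (fun i => if i == n then u else 0); split=> [i|].
  by case: eqP => [->//|_]; exact: Sigma_deg0.
by rewrite -big_mkcond (big_pred1 ord_max).
Qed.

Lemma Sigma0 : Sigma (0 : kSinf k).
Proof. exact/Sigma_of_deg/(Sigma_deg0 0). Qed.

Lemma SigmaD u v : Sigma u -> Sigma v -> Sigma (u + v).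
Proof.
move=> [N [w [hw ->]]] [N' [w' [hw' ->]]].
(* A family may be nonzero beyond its own bound, so it is zeroed there. *)
pose cut M (f : nat -> kSinf k) i := if (i < M)%N then f i else 0.
have cutE M (f : nat -> kSinf k) : (M <= maxn N N')%N ->
    \sum_(i < M) f i = \sum_(i < maxn N N') cut M f i.
  by move=> h; rewrite (big_ord_widen _ f h) big_mkcond.
exists (maxn N N'), (fun i => cut N w i + cut N' w' i); split=> [i|].
  by apply: Sigma_degD; rewrite /cut; case: ifP => // _; exact: Sigma_deg0.
by rewrite big_split (cutE _ w (leq_maxl N N')) (cutE _ w' (leq_maxr N N')).
Qed.

Lemma SigmaZ c u : Sigma u -> Sigma (c *: u).
Proof.
move=> [N [w [hw ->]]]; exists N, (fun i => c *: w i).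
by split=> [i|]; [exact: Sigma_degZ | rewrite scaler_sumr].
Qed.

Lemma Sigma_sum (I : Type) (r : seq I) (P : pred I) (F : I -> kSinf k) :
  (forall i, P i -> Sigma (F i)) -> Sigma (\sum_(i <- r | P i) F i).
Proof. by move=> h; apply: big_ind => //; [exact: Sigma0 | exact: SigmaD]. Qed.

Lemma Sigma_ind (Q : kSinf k -> Prop) :
    Q 0 -> (forall u v, Q u -> Q v -> Q (u + v)) ->
    (forall c u, Q u -> Q (c *: u)) -> (forall a, Q (X k a)) ->
  forall u, Sigma u -> Q u.
Proof.
move=> Q0 QD QZ QX _ [N [w [hw ->]]]; apply: (big_ind Q) => // i _.
have [l [c [_ ->]]] := hw i.
by apply: (big_ind Q) => // a _; exact: QZ.
Qed.

End SigmaModule.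

(** * Bilinearity of the Heisenberg product *)

Section HeisBilinear.
Variable k : fieldType.
Implicit Types u v w : kSinf k.

(** The supports in [heis] vary with the arguments; larger sets only add vanishing terms and give a
    common index set. *)
Lemma heisEw (d e : {fset {n : nat & 'S_n}}) u v :
    (msupp u `<=` d)%fset -> (msupp v `<=` e)%fset ->
  heis u v = \sum_(s <- d) \sum_(t <- e)
               (u@_s * v@_t) *: heis_perm k (tagged s) (tagged t).
Proof.
move=> hu hv; rewrite /heis (big_fset_incl _ hu) /=.
  apply: eq_bigr => s _; rewrite (big_fset_incl _ hv) //= => t _ /mcoeff_outdom ->.
  by rewrite mulr0 scale0r.
move=> s _ /mcoeff_outdom ->; rewrite big1 // => t _.
by rewrite mul0r scale0r.
Qed.

Lemma heisDl u u' v : heis (u + u') v = heis u v + heis u' v.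
Proof.
pose d := (msupp u `|` msupp u')%fset.
rewrite !(@heisEw d (msupp v)) ?fsubset_refl ?fsubsetUl ?fsubsetUr ?msuppD_le //.
rewrite -big_split; apply: eq_bigr => s _; rewrite -big_split.
by apply: eq_bigr => t _; rewrite mcoeffD mulrDl scalerDl.
Qed.

Lemma heisDr u v v' : heis u (v + v') = heis u v + heis u v'.
Proof.
pose e := (msupp v `|` msupp v')%fset.
rewrite !(@heisEw (msupp u) e) ?fsubset_refl ?fsubsetUl ?fsubsetUr ?msuppD_le //.
rewrite -big_split; apply: eq_bigr => s _; rewrite -big_split.
by apply: eq_bigr => t _; rewrite mcoeffD mulrDr scalerDl.
Qed.

Lemma heisZl c u v : heis (c *: u) v = c *: heis u v.
Proof.
rewrite !(@heisEw (msupp u) (msupp v)) ?fsubset_refl ?msuppZ_le //.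
rewrite scaler_sumr; apply: eq_bigr => s _; rewrite scaler_sumr.
by apply: eq_bigr => t _; rewrite mcoeffZ -mulrA scalerA.
Qed.

Lemma heisZr c u v : heis u (c *: v) = c *: heis u v.
Proof.
rewrite !(@heisEw (msupp u) (msupp v)) ?fsubset_refl ?msuppZ_le //.
rewrite scaler_sumr; apply: eq_bigr => s _; rewrite scaler_sumr.
by apply: eq_bigr => t _; rewrite mcoeffZ mulrCA scalerA.
Qed.

Lemma heis0l v : heis 0 v = 0.
Proof. by have := heisZl 0 0 v; rewrite !scale0r. Qed.

Lemma heis0r u : heis u 0 = 0.
Proof. by have := heisZr 0 u 0; rewrite !scale0r. Qed.

Lemma heis_perm_elt p q (s : 'S_p) (t : 'S_q) :
  heis (perm_elt k s) (perm_elt k t) = heis_perm k s t.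
Proof.
rewrite /heis /perm_elt !msuppU oner_eq0 !big_seq_fset1 !mcoeffUU.
by rewrite mul1r scale1r.
Qed.

Lemma heis_sum (I I' : Type) (r : seq I) (P : pred I) (F : I -> kSinf k)
    (r' : seq I') (P' : pred I') (F' : I' -> kSinf k) :
  heis (\sum_(i <- r | P i) F i) (\sum_(j <- r' | P' j) F' j) =
  \sum_(i <- r | P i) \sum_(j <- r' | P' j) heis (F i) (F' j).
Proof.
rewrite (big_morph (fun u => heis u _) (fun u u' => heisDl u u' _) (heis0l _)).
by apply: eq_bigr => i _; rewrite (big_morph (heis _) (heisDr _) (heis0r _)).
Qed.

End HeisBilinear.

(** * Summation over label words and conclusion *)

(** For fixed [r = s \op t], [labF] is a bijection from the [t] with [left_ok (r \op t^-1)] to all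
    label words, and [right_ok_natF] translates the condition on [t]. *)
Lemma sum_left_right (k : fieldType) n p q (D1 D2 : pred nat) :
  \sum_(s : 'S_n | left_ok p D1 s) \sum_(t : 'S_n | right_ok p q D2 t)
      perm_elt k (s \op t) =
  \sum_(F in [set labF p D1 t | t : 'S_n] | valid n q D2 (natF F))
      Xdes k n (cuts n q D2 (natF F)).
Proof.
rewrite exchange_big /=.
transitivity (\sum_(t : 'S_n | right_ok p q D2 t)
    \sum_(r | left_ok p D1 (r \op t^-1)) perm_elt k r).
  apply: eq_bigr => t _; rewrite (reindex_inj (mulgI t^-1)%g) /=.
  by apply: eq_bigr => r _; rewrite /perm_comp mulKVg.
rewrite (exchange_big_dep predT) //= [RHS](exchange_big_dep predT) //=.
apply: eq_bigr => r _.
rewrite (labF_image p D1 r) (eq_bigl (fun F =>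
  (F \in labF p D1 @: [set t | left_ok p D1 (r \op t^-1)]) &&
  (valid n q D2 (natF F) && [forall i in Des r, cuts n q D2 (natF F) i])));
  last by move=> F; rewrite andbA.
rewrite big_imset_cond; last exact: labF_inj.
apply: eq_bigl => t; rewrite inE andbC; apply: andb_id2l; exact: right_ok_natF.
Qed.

(** Since [(s eta) x Id = (s x Id)(eta x Id)], the middle factor can be shared between the two
    sides. *)
Lemma prod_factor n p q (s : 'S_p) (t : 'S_q) (xi : 'S_(p + (n - p)))
    (eta : 'S_((p + q - n) + (n - q))) :
    (p <= n)%N -> (q <= n)%N -> (n <= p + q)%N ->
  conform_perm n xi
    \op conform_perm n (perm_par (s \op conform_perm p eta) (1%g : 'S_(n - p)))
    \op conform_perm n (beta (2 * n - p - q) (p + q - n))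
    \op conform_perm n (perm_par (1%g : 'S_(n - q)) t) =
  left_prod (s, xi) \op right_prod (t, eta).
Proof.
move=> hp hq hn; apply: pact_ext => x _; rewrite !pact_comp.
set y := pact _ (pact _ x); rewrite !pact_conform ?subnKC // !pact_par !pact1.
congr pact; case: ltnP => hy; first by rewrite pact_lt hy pact_comp.
by rewrite (subnKC hy) ltnNge hy /= (subnKC hy).
Qed.

Lemma Sigma_heis_X (k : fieldType) a b : Sigma (heis (X k a) (X k b)).
Proof.
pose p := sumn a; pose q := sumn b; pose D1 := mem (J a); pose D2 := mem (J b).
rewrite -[X k a]/(Xdes k p D1) -[X k b]/(Xdes k q D2) heis_sum.
under eq_bigr do under eq_bigr do rewrite heis_perm_elt.
(* Moving [n] outermost isolates the homogeneous components. *)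
rewrite /heis_perm; under eq_bigr do rewrite exchange_big /=.
rewrite exchange_big /= big_seq; apply: Sigma_sum => n.
rewrite mem_index_iota geq_max => /andP[/andP[hp hq] hn].
apply: (@Sigma_of_deg _ n).
have -> : \sum_(s : 'S_p | [forall i in Des s, D1 i])
    \sum_(t : 'S_q | [forall i in Des t, D2 i])
    \sum_(xi in Sh p (n - p)) \sum_(eta in Sh (p + q - n) (n - q))
      perm_elt k (conform_perm n xi
        \op conform_perm n (perm_par (s \op conform_perm p eta) (1%g : 'S_(n - p)))
        \op conform_perm n (beta (2 * n - p - q) (p + q - n))
        \op conform_perm n (perm_par (1%g : 'S_(n - q)) t)) =
    \sum_(su in left_dom n p D1) \sum_(tu in right_dom n p q D2)
      perm_elt k (left_prod su \op right_prod tu).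
  under eq_bigr do rewrite exchange_big /=.
  rewrite pair_big; apply: eq_big => [su | [s xi] _]; first by rewrite [RHS]inE.
  rewrite pair_big; apply: eq_big => [tu | [t eta] _]; first by rewrite [RHS]inE.
  by rewrite prod_factor.
(* Injectivity and image turn the sum over pairs into one over permutations; likewise for
   [left_prod] below. *)
have right_sum s : \sum_(tu in right_dom n p q D2) perm_elt k (s \op right_prod tu) =
    \sum_(t | right_ok p q D2 t) perm_elt k (s \op t).
  rewrite -(big_imset (fun t => perm_elt k (s \op t)) (right_prod_inj hp hq hn)).
  by rewrite right_prod_image //; apply: eq_bigl => t; rewrite inE.
under eq_bigr do rewrite right_sum.
rewrite -(big_imset (fun s => \sum_(t | right_ok p q D2 t) perm_elt k (s \op t))
            (left_prod_inj hp)) left_prod_image //=.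
under eq_bigl do rewrite inE.
by rewrite sum_left_right; apply: Sigma_deg_sum => F _; exact: Sigma_deg_Xdes.
Qed.

Theorem theorem7p3 (k : fieldType) (hk : [pchar k] =i pred0) (u v : kSinf k) :
  Sigma u -> Sigma v -> Sigma (heis u v).
Proof.
move=> hu hv; move: hu; elim/Sigma_ind: u / => [|u u' hu hu' | c u hu | a].
- by rewrite heis0l; exact: Sigma0.
- by rewrite heisDl; exact: SigmaD.
- by rewrite heisZl; exact: SigmaZ.
move: hv; elim/Sigma_ind: v / => [|v v' hv hv' | c v hv | b].
- by rewrite heis0r; exact: Sigma0.
- by rewrite heisDr; exact: SigmaD.
- by rewrite heisZr; exact: SigmaZ.
exact: Sigma_heis_X.
Qed.
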